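(* Each of the full embedding functors $\mathbf{\Sigma}_{\mathrm s}\hookrightarrow\mathbf{\Sigma}_{\mathrm w}$, $\mathbf{\Sigma}_{\mathrm g}\hookrightarrow\mathbf{\Sigma}_{\mathrm{ft}}$ and $\mathbf{\Sigma}_{\mathrm{ft}}\hookrightarrow\mathbf{\Sigma}_{\mathrm w}$ is a right adjoint (i.e. has a left adjoint).
   Context: Families. Fix an infinite set $\mathcal I$. A family of elements of a set $X$ is an indexed multiset $\{x_i\}_{i\in I}$ with $x_i\in X$ and $I\subseteq\mathcal I$ countable (finite and empty allowed); two families $\{x_i\}_I,\{y_j\}_J$ are identified if there is a bijection $\phi\colon I\to J$ with $x_i=y_{\phi(i)}$ for all $i$. $X^*$ is the set of all families; bold letters denote families. The disjoint union $\uplus_J\mathbf x_j$ of families is indexed by the disjoint union of the index sets. A subfamily is the restriction of a family to a subset of its index set. For $f\colon X\to Y$ and $\mathbf x=\{x_i\}_I$, $f\mathbf x=\{f(x_i)\}_I$. For a partial function $\Sigma\colon X^*\rightharpoonup X$, ''$\Sigma\mathbf x\simeq x$'' means $\Sigma\mathbf x$ is defined and equals $x$; $\mathbf x$ is summable if $\Sigma\mathbf x$ is defined. A weak $\Sigma$-monoid is a set $X$ with a partial function $\Sigma\colon X^*\rightharpoonup X$ such that: (Singleton) $\Sigma\{x\}\simeq x$ for all $x\in X$; (Neutral element) there is $0\in X$ with $\Sigma\emptyset\simeq 0$, and if $\mathbf x$ is summable then so is its subfamily $\mathbf x_\emptyset$ of elements other than $0$; (Bracketing) if $\{\mathbf x_j\}_J$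 ($J$ countable) is an indexed set of finite summable families and $\mathbf x=\uplus_J\mathbf x_j$, then $\Sigma\mathbf x\simeq x$ implies $\Sigma\{\Sigma\mathbf x_j\}_J\simeq x$; (Flattening) if $\{\mathbf x_j\}_J$ is a finite indexed set of (possibly infinite) summable families and $\mathbf x=\uplus_J\mathbf x_j$, then $\Sigma\{\Sigma\mathbf x_j\}_J\simeq x$ implies $\Sigma\mathbf x\simeq x$. A $\Sigma$-homomorphism $f\colon(X,\Sigma)\to(Y,\Sigma')$ is a function such that $\Sigma\mathbf x\simeq x$ implies $\Sigma' f\mathbf x\simeq f(x)$, for all $\mathbf x\in X^*$, $x\in X$. A strong $\Sigma$-monoid is a weak $\Sigma$-monoid in which every subfamily of a summable family is summable, and in which, for every (countably) indexed set $\{\mathbf x_j\}_J$ of summable families with $\mathbf x=\uplus_J\mathbf x_j$ (no finiteness required), $\Sigma\mathbf x\simeq x$ implies $\Sigma\{\Sigma\mathbf x_j\}_J\simeq x$, and $\Sigma\{\Sigma\mathbf x_j\}_J\simeq x$ implies $\Sigma\mathbf x\simeq x$. A finitely total $\Sigma$-monoid is a weak $\Sigma$-monoid in which every finite family is summable. A $\Sigma$-group is a finitely total $\Sigma$-monoid such that for every $x$ there is $-x\in X$ with $\Sigma\{x,-x\}=0$ and $x\mapsto -x$ is a $\Sigma$-homomorphism. $\mathbf{\Sigma}_{\mathrm w}$ is the category of weak $\Sigma$-monoids and $\Sigma$-homomorphisms; $\mathbf{\Sigma}_{\mathrm s}$, $\mathbf{\Sigma}_{\mathrm{ft}}$, $\mathbf{\Sigma}_{\mathrm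 g}$ are its full subcategories of strong $\Sigma$-monoids, finitely total $\Sigma$-monoids and $\Sigma$-groups, respectively. *)

(* Defs.v *)
From mathcomp Require Import all_boot.
From mathcomp Require Import boolp classical_sets functions cardinality.

Set Implicit Arguments.
Unset Strict Implicit.
Unset Printing Implicit Defensive.

Local Open Scope classical_set_scope.

(* Index sets are countable subsets of a fixed type [I], assumed infinite in
   the theorem; a set [A : set I] coerces to the type of its elements.  Families
   are not quotiented by reindexing: partial functions on families are instead
   required to be invariant under it (field [sigma_reindex] below). *)
Record fam (I X : Type) := Fam {
  idx : set I;
  idx_countable : countable idx;
  elt : idx -> X
}.
Arguments Fam {I X idx}.

(* [x] is, up to a bijective reindexing, the family {e t}_{t : T}.  The index
   type [T] need not be a subset of [I]; as [I] is infinite, every countable [T]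
   is in bijection with the index set of some family. *)
Definition is_family (I X T : Type) (e : T -> X) (x : fam I X) : Prop :=
  exists phi : T -> idx x, bijective phi /\ forall t, elt (phi t) = e t.

Definition reindexing (I X : Type) (x y : fam I X) : Prop :=
  is_family (@elt I X x) y.

Definition is_empty_family (I X : Type) : fam I X -> Prop :=
  is_family (of_void X).

Definition is_singleton (I X : Type) (a : X) : fam I X -> Prop :=
  is_family (fun _ : unit => a).

Definition is_pair (I X : Type) (a b : X) : fam I X -> Prop :=
  is_family (fun t : bool => if t then a else b).

Definition is_disjoint_union (I X : Type) (xs : fam I (fam I X)) :
    fam I X -> Prop :=
  is_family (fun p : {j : idx xs & idx (elt j)} => elt (projT2 p)).

Definition map_family (I X Y : Type) (f : X -> Y) (x : fam I X) :
    fam I Y :=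
  Fam (idx_countable x) (f \o @elt I X x).

Lemma subfamily_countable (I X : Type) (x : fam I X) (D : set I) :
  countable (idx x `&` D).
Proof.
exact: sub_countable (subset_card_le (@subIsetl _ _ _)) (idx_countable x).
Qed.

Definition subfamily_idx (I : Type) (A D : set I) (i : A `&` D) : A :=
  exist _ (sval i) (mem_set (proj1 (set_mem (svalP i)))).

Definition subfamily (I X : Type) (x : fam I X) (D : set I) : fam I X :=
  Fam (subfamily_countable x D) (@elt I X x \o @subfamily_idx I (idx x) D).

Definition remove_elt (I X : Type) (z : X) (x : fam I X) : fam I X :=
  subfamily x [set sval i | i in [set i : idx x | elt i <> z]].

(* A partial function into [X] is a function into [option X]; [S x = Some a]
   says that [S x] is defined and equal to [a]. *)
Definition summable (I X : Type) (S : fam I X -> option X)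
    (x : fam I X) : Prop :=
  exists a, S x = Some a.

(* In the next two definitions the hypothesis on [s] says that every [elt j] is
   summable with sum [s j], so [Fam (idx_countable xs) s] is the family of
   these sums. *)
Definition bracketing (I X : Type) (S : fam I X -> option X)
    (P : set (fam I (fam I X))) : Prop :=
  forall (xs : fam I (fam I X)) (s : idx xs -> X) (x : fam I X) (a : X),
    P xs -> is_disjoint_union xs x -> (forall j, S (elt j) = Some (s j)) ->
    S x = Some a -> S (Fam (idx_countable xs) s) = Some a.

Definition flattening (I X : Type) (S : fam I X -> option X)
    (P : set (fam I (fam I X))) : Prop :=
  forall (xs : fam I (fam I X)) (s : idx xs -> X) (x : fam I X) (a : X),
    P xs -> is_disjoint_union xs x -> (forall j, S (elt j) = Some (s j)) ->
    S (Fam (idx_countable xs) s) = Some a -> S x = Some a.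

(* The neutral element is stored as data: it is the sum of the empty family,
   hence determined by [sigma]. *)
Record weak_sigma_monoid (I : Type) := WeakSigmaMonoid {
  carrier :> Type;
  sigma : fam I carrier -> option carrier;
  neutral : carrier;
  sigma_reindex : forall x y, reindexing x y -> sigma x = sigma y;
  sigma_singleton : forall a x, is_singleton a x -> sigma x = Some a;
  sigma_empty : forall x, is_empty_family x -> sigma x = Some neutral;
  summable_remove_neutral :
    forall x, summable sigma x -> summable sigma (remove_elt neutral x);
  sigma_bracketing :
    bracketing sigma [set xs | forall j : idx xs, finite_set (idx (elt j))];
  sigma_flattening : flattening sigma [set xs | finite_set (idx xs)]
}.
Arguments sigma {I w}.
Arguments neutral {I w}.

Definition is_sigma_hom (I : Type) (X Y : weak_sigma_monoid I) (f : X -> Y) :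
    Prop :=
  forall (x : fam I X) (a : X),
    sigma x = Some a -> sigma (map_family f x) = Some (f a).

Definition is_strong (I : Type) (X : weak_sigma_monoid I) : Prop :=
  [/\ forall (x : fam I X) (D : set I),
        summable sigma x -> summable sigma (subfamily x D),
      bracketing (@sigma I X) setT &
      flattening (@sigma I X) setT].

Definition is_finitely_total (I : Type) (X : weak_sigma_monoid I) : Prop :=
  forall x : fam I X, finite_set (idx x) -> summable sigma x.

Definition is_sigma_group (I : Type) (X : weak_sigma_monoid I) : Prop :=
  is_finitely_total X /\
  exists neg : X -> X,
    (forall (a : X) (x : fam I X),
       is_pair a (neg a) x -> sigma x = Some neutral) /\
    is_sigma_hom neg.

Record category := Category {
  obj :> Type;
  hom : obj -> obj -> Type;
  idm : forall a, hom a a;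
  compm : forall a b c, hom b c -> hom a b -> hom a c;
  comp_idl : forall a b (f : hom a b), compm (idm b) f = f;
  comp_idr : forall a b (f : hom a b), compm f (idm a) = f;
  comp_assoc : forall a b c d (h : hom c d) (g : hom b c) (f : hom a b),
    compm h (compm g f) = compm (compm h g) f
}.
Arguments idm {_} a.

Record functor (C D : category) := Functor {
  fobj :> C -> D;
  fmap : forall a b, hom a b -> hom (fobj a) (fobj b);
  fmap_id : forall a, fmap (idm a) = idm (fobj a);
  fmap_comp : forall a b c (g : hom b c) (f : hom a b),
    fmap (compm g f) = compm (fmap g) (fmap f)
}.
Arguments fmap {_ _} _ {_ _}.

Definition adjoint (C D : category) (F : functor C D) (G : functor D C) : Prop :=
  exists adj : forall (c : C) (d : D), hom (F c) d -> hom c (G d),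
    [/\ forall c d, bijective (adj c d),
        forall c' c d (f : hom c' c) (h : hom (F c) d),
          adj c' d (compm h (fmap F f)) = compm (adj c d h) f &
        forall c d d' (g : hom d d') (h : hom (F c) d),
          adj c d' (compm g h) = compm (fmap G g) (adj c d h)].

Definition is_right_adjoint (C D : category) (G : functor D C) : Prop :=
  exists F : functor C D, adjoint F G.

Definition full_subcategory (C : category) (P : C -> Prop) : category :=
  @Category {c : C | P c} (fun a b => hom (sval a) (sval b))
    (fun a => idm (sval a)) (fun a b c g f => compm g f)
    (fun a b f => comp_idl f) (fun a b f => comp_idr f)
    (fun a b c d h g f => comp_assoc h g f).

Definition full_embedding (C : category) (P : C -> Prop) :
    functor (full_subcategory P) C :=
  @Functor (full_subcategory P) C (fun a => sval a) (fun a b f => f)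
    (fun a => erefl) (fun a b c g f => erefl).

Definition full_embedding_sub (C : category) (P Q : C -> Prop)
    (PQ : forall c, P c -> Q c) :
    functor (full_subcategory P) (full_subcategory Q) :=
  @Functor (full_subcategory P) (full_subcategory Q)
    (fun a => exist Q (sval a) (PQ _ (svalP a))) (fun a b f => f)
    (fun a => erefl) (fun a b c g f => erefl).

Record sigma_hom (I : Type) (X Y : weak_sigma_monoid I) := SigmaHom {
  sigma_fun :> X -> Y;
  sigma_funP : is_sigma_hom sigma_fun
}.

Lemma sigma_hom_eq (I : Type) (X Y : weak_sigma_monoid I)
    (f g : sigma_hom X Y) : sigma_fun f = sigma_fun g -> f = g.
Proof.
case: f g => [f fP] [g gP] /= fg; case: g / fg gP => gP.
by congr SigmaHom; exact: Prop_irrelevance.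
Qed.

Lemma is_sigma_hom_id (I : Type) (X : weak_sigma_monoid I) :
  is_sigma_hom (fun a : X => a).
Proof. by move=> [A cA x] a. Qed.

Lemma is_sigma_hom_comp (I : Type) (X Y Z : weak_sigma_monoid I)
    (g : sigma_hom Y Z) (f : sigma_hom X Y) : is_sigma_hom (g \o f).
Proof. by move=> x a xa; exact: sigma_funP (sigma_funP f xa). Qed.

Definition sigma_id (I : Type) (X : weak_sigma_monoid I) : sigma_hom X X :=
  SigmaHom (@is_sigma_hom_id I X).

Definition sigma_comp (I : Type) (X Y Z : weak_sigma_monoid I)
    (g : sigma_hom Y Z) (f : sigma_hom X Y) : sigma_hom X Z :=
  SigmaHom (is_sigma_hom_comp g f).

Lemma sigma_comp_idl (I : Type) (X Y : weak_sigma_monoid I)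
    (f : sigma_hom X Y) : sigma_comp (sigma_id Y) f = f.
Proof. exact: sigma_hom_eq. Qed.

Lemma sigma_comp_idr (I : Type) (X Y : weak_sigma_monoid I)
    (f : sigma_hom X Y) : sigma_comp f (sigma_id X) = f.
Proof. exact: sigma_hom_eq. Qed.

Lemma sigma_comp_assoc (I : Type) (X Y Z T : weak_sigma_monoid I)
    (h : sigma_hom Z T) (g : sigma_hom Y Z) (f : sigma_hom X Y) :
  sigma_comp h (sigma_comp g f) = sigma_comp (sigma_comp h g) f.
Proof. exact: sigma_hom_eq. Qed.

Definition Sigma_w (I : Type) : category :=
  @Category (weak_sigma_monoid I) (@sigma_hom I) (@sigma_id I) (@sigma_comp I)
    (@sigma_comp_idl I) (@sigma_comp_idr I) (@sigma_comp_assoc I).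

Definition Sigma_s (I : Type) : category :=
  @full_subcategory (Sigma_w I) (@is_strong I).

Definition Sigma_ft (I : Type) : category :=
  @full_subcategory (Sigma_w I) (@is_finitely_total I).

Definition Sigma_g (I : Type) : category :=
  @full_subcategory (Sigma_w I) (@is_sigma_group I).

Definition embed_s_w (I : Type) : functor (Sigma_s I) (Sigma_w I) :=
  @full_embedding (Sigma_w I) (@is_strong I).

Definition embed_ft_w (I : Type) : functor (Sigma_ft I) (Sigma_w I) :=
  @full_embedding (Sigma_w I) (@is_finitely_total I).

Definition embed_g_ft (I : Type) : functor (Sigma_g I) (Sigma_ft I) :=
  @full_embedding_sub (Sigma_w I) (@is_sigma_group I) (@is_finitely_total I)
    (fun X => @proj1 _ _).

(* Main.v *)
(* All three subcategories are reflective for the same reason.  Let P be one of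
   the three classes.  It is closed under products with coordinatewise partial
   sums, and under subsets closed under those sums (and, for groups, under
   inverses); so the reflection of X is the part generated by X of the product
   of the targets of all morphisms from X to members of P.  The morphisms form
   a large collection, but every element generated by X is named by a countably
   branching term over X, and such terms form a set.  Inverses are unique in
   every weak Sigma-monoid and preserved by homomorphisms, so the terms may
   involve formal inverses in all three cases. *)
Require Import Defs.
From mathcomp Require Import all_boot.
From mathcomp Require Import boolp classical_sets functions cardinality.

Set Implicit Arguments.
Unset Strict Implicit.
Unset Printing Implicit Defensive.

Local Open Scope classical_set_scope.

(** * Bijections, countability and families over arbitrary index types *)

Lemma injective_surjective_bijective (A B : Type) (f : A -> B) :
  injective f -> (forall b, exists a, f a = b) -> bijective f.
Proof.
move=> f_inj f_surj; have [g gK] := choice f_surj.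
by exists g => // a; apply: f_inj.
Qed.

Lemma bijective_surjective (A B : Type) (f : A -> B) (b : B) :
  bijective f -> exists a, f a = b.
Proof. by case=> g _ fK; exists (g b). Qed.

Lemma bijective_sigT (J K : Type) (T : J -> Type) (U : K -> Type)
    (phi : K -> J) (psi : forall k, U k -> T (phi k)) :
  bijective phi -> (forall k, bijective (psi k)) ->
  bijective (fun p : {k & U k} => existT T (phi (tag p)) (psi _ (tagged p))).
Proof.
move=> phi_bij psi_bij; apply: injective_surjective_bijective.
  move=> [k u] [k' u'] /= e.
  have kk' : k = k' := bij_inj phi_bij (congr1 (@tag _ _) e).
  case: _ / kk' u' e => u' e.
  congr existT; apply: (bij_inj (psi_bij k)).
  (* After [k] and [k'] are identified, the transport in [projT2_eq] is along a loop, which proof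
     irrelevance turns into [erefl]. *)
  by have := projT2_eq e; rewrite (Prop_irrelevance (projT1_eq e) erefl).
case=> j t; have [k kj] := bijective_surjective j phi_bij.
case: _ / kj t => t; have [u <-] := bijective_surjective t (psi_bij k).
by exists (existT U k u).
Qed.

Lemma is_family_comp (I X T T' : Type) (e : T -> X) (phi : T' -> T)
    (x : fam I X) :
  bijective phi -> is_family e x -> is_family (e \o phi) x.
Proof.
move=> phi_bij [psi [psi_bij psiE]]; exists (psi \o phi).
by split=> [|t]; [exact: bij_comp | rewrite /= psiE].
Qed.

Lemma is_family_unique (I X T : Type) (e : T -> X) (x y : fam I X) :
  is_family e x -> is_family e y -> reindexing x y.
Proof.
move=> [phi [[psi phiK psiK] phiE]] [phi' [phi'_bij phi'E]].
exists (phi' \o psi); split=> [|i] /=; last by rewrite phi'E -phiE psiK.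
by apply: bij_comp => //; exists phi.
Qed.

Lemma is_family_elt (I X : Type) (x : fam I X) : is_family (@elt I X x) x.
Proof. by exists id; split=> //; exists id. Qed.

Lemma is_family_finite (I X T : Type) (e : T -> X) (x : fam I X) :
  is_family e x -> finite_set [set: T] -> finite_set (idx x).
Proof.
move=> [phi [phi_bij _]] T_fin.
suff -> : idx x = (sval \o phi) @` setT by exact: finite_image.
apply/seteqP; split=> [i xi|_ [t _ <-]]; last exact: set_mem (svalP (phi t)).
have [t ti] := bijective_surjective (exist _ i (mem_set xi)) phi_bij.
by exists t => //=; rewrite ti.
Qed.

Lemma countable_idxT (I X : Type) (x : fam I X) : countable [set: idx x].
Proof. by rewrite (eq_countable (card_setT _)); exact: idx_countable. Qed.

(** A countable [T] injects into the infinite type [I], and the range of the injection serves as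
    index set. *)
Lemma is_family_exists (I X T : Type) (e : T -> X) :
  infinite_set [set: I] -> countable [set: T] ->
  exists x : fam I X, is_family e x.
Proof.
move=> /infiniteP I_inf T_count.
have /card_leP[f] := card_le_trans T_count I_inf.
pose g (t : T) : I := sval (f (exist _ t (mem_setT t))).
have g_inj : injective g.
  move=> t t' /val_inj gtt'.
  by have [] := @inj _ _ _ f _ _ (mem_setT _) (mem_setT _) gtt'.
have gP t : g t \in range g by apply: mem_set; exists t.
pose phi t : range g := exist _ (g t) (gP t).
have phi_bij : bijective phi.
  apply: injective_surjective_bijective => [t t' [/g_inj]//|[i gi]].
  have [t _ ti] := set_mem gi; exists t; exact: eq_exist.
have [psi phiK psiK] := phi_bij.
have cR : countable (range g).
  exact: card_le_trans (card_image_le _ _) T_count.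
by exists (Fam cR (e \o psi)), phi; split=> // t /=; rewrite phiK.
Qed.

Lemma injective_countable (A B : Type) (f : A -> B) :
  injective f -> countable [set: B] -> countable [set: A].
Proof.
move=> f_inj /countable_injP[g g_inj]; apply/countable_injP.
by exists (g \o f) => a b _ _ /(g_inj _ _ (in_setT _) (in_setT _)) /f_inj.
Qed.

Lemma countable_sigT (J : Type) (T : J -> Type) :
  countable [set: J] -> (forall j, countable [set: T j]) ->
  countable [set: {j & T j}].
Proof.
move=> /countable_injP[g g_inj] T_count.
have F (j : J) : {f : T j -> nat | injective f}.
  apply: cid; have /countable_injP[f f_inj] := T_count j; exists f => t t'.
  exact: f_inj (in_setT _) (in_setT _).
pose f (p : {j & T j}) := (g (tag p), sval (F (tag p)) (tagged p)).
apply: (@injective_countable _ _ f) (countableP _) => -[j t] [j' t'] [].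
move=> /(g_inj _ _ (in_setT _) (in_setT _)) jj'; case: _ / jj' t' => t'.
by move=> /(svalP (F j)) ->.
Qed.

Lemma is_family_countable (I X T : Type) (e : T -> X) (x : fam I X) :
  is_family e x -> countable [set: T].
Proof.
move=> [phi [/bij_inj/injective_countable + _]]; apply.
exact: countable_idxT.
Qed.

Lemma is_family_sym (I X T : Type) (e : T -> X) (x : fam I X) :
  is_family e x ->
  exists psi : idx x -> T, bijective psi /\ forall i, e (psi i) = elt i.
Proof.
move=> [phi [[psi phiK psiK] phiE]]; exists psi; split; first by exists phi.
by move=> i; rewrite -phiE psiK.
Qed.

(** * Calculus of sums in a weak Sigma-monoid *)

(** Sums over any index type: [bool], sum types and dependent pairs can then be used directly,
    without embedding them in [I] each time. By [sigma_reindex] the choice of [x] does not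
    matter. *)
Definition sums_to (I : Type) (X : weak_sigma_monoid I) (T : Type)
    (e : T -> X) (a : X) : Prop :=
  exists2 x : fam I X, is_family e x & sigma x = Some a.

Section Sums.
Context (I : Type) (X : weak_sigma_monoid I).

Lemma sigma_sums_to (T : Type) (e : T -> X) (x : fam I X) (a : X) :
  is_family e x -> sums_to e a -> sigma x = Some a.
Proof.
by move=> ex [y ey <-]; apply: sigma_reindex; exact: is_family_unique ex ey.
Qed.

Lemma sums_to_comp (T T' : Type) (e : T -> X) (phi : T' -> T) (a : X) :
  bijective phi -> sums_to e a -> sums_to (e \o phi) a.
Proof. by move=> phi_bij [x ex xa]; exists x => //; exact: is_family_comp. Qed.

Lemma eq_sums_to (T : Type) (e e' : T -> X) (a : X) :
  e =1 e' -> sums_to e a -> sums_to e' a.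
Proof. by move=> /funext ->. Qed.

Lemma sums_to_fun (T : Type) (e : T -> X) (a b : X) :
  sums_to e a -> sums_to e b -> a = b.
Proof.
by move=> [x ex xa] eb; have := sigma_sums_to ex eb; rewrite xa => -[].
Qed.

Hypothesis I_infinite : infinite_set [set: I].

Lemma sums_to_unit (a : X) : sums_to (fun _ : unit => a) a.
Proof.
have [x ax] := is_family_exists (fun _ : unit => a) I_infinite (countableP _).
by exists x => //; exact: sigma_singleton.
Qed.

Lemma sums_to_void : sums_to (of_void X) neutral.
Proof.
have [x ex] := is_family_exists (of_void X) I_infinite (countableP _).
by exists x => //; exact: sigma_empty.
Qed.

Section DisjointUnion.
Context (J : Type) (T : J -> Type) (e : forall j, T j -> X) (s : J -> X).
Hypothesis J_countable : countable [set: J].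
Hypothesis es : forall j, sums_to (e (j:=j)) (s j).

(** The axioms speak of [fam I (fam I X)]. Choosing a family for each [j], and then a family of
    these, puts the data in that form, at the price of a reindexing [psi] of [J]. *)
Lemma family_of_families :
  exists (xs : fam I (fam I X)) (psi : idx xs -> J),
    [/\ bijective psi, forall k, sigma (elt k) = Some (s (psi k)),
        forall k, is_family (e (j:=psi k)) (elt k) &
        forall y, is_family (fun p : {j & T j} => e (tagged p)) y ->
          is_disjoint_union xs y].
Proof.
have /choice[x xP] : forall j, exists x : fam I X,
    is_family (e (j:=j)) x /\ sigma x = Some (s j).
  by move=> j; have [x] := es j; exists x.
have [xs /is_family_sym[psi [psi_bij psiE]]] :=
  is_family_exists x I_infinite J_countable.
have ek k : is_family (e (j:=psi k)) (elt k) by rewrite -psiE; exact: (xP _).1.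
exists xs, psi; split=> // [k|y ey]; first by rewrite -psiE; exact: (xP _).2.
have fP k := svalP (cid (is_family_sym (ek k))).
have := is_family_comp (bijective_sigT psi_bij (fun k => (fP k).1)) ey.
by congr is_family; apply: funext => -[k u] /=; rewrite (fP k).2.
Qed.

Lemma sums_to_bracketing (a : X) :
  (forall j, finite_set [set: T j]) ->
  sums_to (fun p : {j & T j} => e (tagged p)) a -> sums_to s a.
Proof.
move=> T_fin [y ey ya].
have [xs [psi [[phi psiK phiK] sk ek uy]]] := family_of_families.
exists (Fam (idx_countable xs) (s \o psi)).
  by exists phi; split=> [|j] /=; [exists psi | rewrite phiK].
apply: sigma_bracketing (uy _ ey) sk ya => k.
exact: is_family_finite (ek k) _.
Qed.

Lemma sums_to_flattening (a : X) :
  finite_set [set: J] ->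
  sums_to s a -> sums_to (fun p : {j & T j} => e (tagged p)) a.
Proof.
move=> J_fin sa.
have [xs [psi [[phi psiK phiK] sk ek uy]]] := family_of_families.
(* Each fibre is countable because it indexes a summable family. *)
have U_count : countable [set: {j & T j}].
  apply: countable_sigT => // j; have [x ex _] := es j.
  exact: is_family_countable ex.
have [y ey] :=
  is_family_exists (fun p : {j & T j} => e (tagged p)) I_infinite U_count.
exists y => //.
have sf : is_family s (Fam (idx_countable xs) (s \o psi)).
  by exists phi; split=> [|j] /=; [exists psi | rewrite phiK].
apply: sigma_flattening (uy _ ey) sk (sigma_sums_to sf sa) => /=.
exact: is_family_finite sf J_fin.
Qed.
End DisjointUnion.

(** The disjoint union of [T] copies of the empty family is empty, and bracketing it this way gives
    a sum of [T] neutral elements. *)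
Lemma sums_to_neutral (T : Type) :
  countable [set: T] -> sums_to (fun _ : T => neutral : X) neutral.
Proof.
move=> T_count.
apply: (@sums_to_bracketing T (fun=> void) (fun=> of_void X)) => //.
  by move=> _; exact: sums_to_void.
have bij : bijective (fun p : {_ : T & void} => tagged p).
  by exists (of_void _) => [[? []]|[]].
by apply: eq_sums_to (sums_to_comp bij sums_to_void) => -[? []].
Qed.

(** This is the function in [is_pair], so [sums_to (pairing a b) c] reads a + b = c. *)
Definition pairing (a b : X) (t : bool) : X := if t then a else b.

Section Sum.
Context (A B : Type) (e : A -> X) (f : B -> X) (a b : X).
Hypotheses (ea : sums_to e a) (fb : sums_to f b).

Definition sum_fun (u : A + B) : X :=
  match u with inl i => e i | inr j => f j end.

(** A binary sum is recast as a disjoint union over [bool], the shape to which bracketing and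
    flattening apply. *)
Let T (t : bool) : Type := if t then A else B.

Let g (t : bool) : T t -> X :=
  match t return T t -> X with true => e | false => f end.

Let g_sum (t : bool) : sums_to (g (t:=t)) (pairing a b t).
Proof. by case: t. Qed.

Let to_sum (p : {t : bool & T t}) : A + B :=
  match p with existT t i =>
    match t return T t -> A + B with true => inl | false => inr end i
  end.

Let of_sum (u : A + B) : {t : bool & T t} :=
  match u with inl i => existT T true i | inr j => existT T false j end.

Let to_sumK : cancel to_sum of_sum. Proof. by case=> -[] u. Qed.
Let of_sumK : cancel of_sum to_sum. Proof. by case. Qed.

Lemma sums_to_sum_fun (c : X) : sums_to (pairing a b) c -> sums_to sum_fun c.
Proof.
move=> /(sums_to_flattening (countableP _) g_sum finite_finset) gc.
by apply: eq_sums_to (sums_to_comp (Bijective of_sumK to_sumK) gc) => -[].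
Qed.

Lemma sums_to_pairing (c : X) :
  finite_set [set: A] -> finite_set [set: B] ->
  sums_to sum_fun c -> sums_to (pairing a b) c.
Proof.
move=> A_fin B_fin sc; apply: sums_to_bracketing (countableP _) g_sum _ _ _ .
  by case.
by apply: eq_sums_to (sums_to_comp (Bijective to_sumK of_sumK) sc) => -[[] ?].
Qed.
End Sum.

(** Bracket the singleton of [a] as itself together with the empty family. *)
Lemma sums_to_add0 (a : X) : sums_to (pairing a neutral) a.
Proof.
apply: (sums_to_pairing (sums_to_unit a) sums_to_void) => //.
pose phi (u : unit + void) :=
  match u with inl t => t | inr v => of_void unit v end.
have phi_bij : bijective phi.
  by exists inl => [[|[]]|].
by apply: eq_sums_to (sums_to_comp phi_bij (sums_to_unit a)) => -[|[]].
Qed.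

Lemma sums_to_pairC (a b c : X) :
  sums_to (pairing a b) c -> sums_to (pairing b a) c.
Proof.
move=> /(sums_to_comp (Bijective negbK negbK)) ba.
by apply: eq_sums_to ba => -[].
Qed.

(** The usual argument, with care for definedness: (a + b) + c = 0 + c = c is defined, so flattening
    makes {a, b, c} summable with sum c. Bracketing it as (a + c) + b = 0 + b then yields b. *)
Lemma inverse_unique (a b c : X) :
  sums_to (pairing a b) neutral -> sums_to (pairing a c) neutral -> b = c.
Proof.
move=> ab ac.
(* The transposition of the last two entries of the triple. *)
pose phi (u : bool + unit) : bool + unit :=
  match u with
  | inl true => inl true
  | inl false => inr tt
  | inr _ => inl false
  end.
have phiK : involutive phi by case=> [[]|[]].
have abc :=
  sums_to_sum_fun ab (sums_to_unit c) (sums_to_pairC (sums_to_add0 c)).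
apply: esym; apply: sums_to_fun (sums_to_pairC (sums_to_add0 b)).
apply: (sums_to_pairing ac (sums_to_unit b)) => //.
by apply: eq_sums_to (sums_to_comp (Bijective phiK phiK) abc) => -[[]|[]].
Qed.

Lemma is_family_subfamilyU (x : fam I X) (D E F : set I) :
  idx x `&` D = idx x `&` (E `|` F) -> E `&` F = set0 ->
  is_family (sum_fun (@elt _ _ (subfamily x E)) (@elt _ _ (subfamily x F)))
    (subfamily x D).
Proof.
move=> DEF EF.
have uE i : (idx x `&` E) i -> (idx x `&` D) i.
  by rewrite DEF => -[xi Ei]; split=> //; left.
have uF i : (idx x `&` F) i -> (idx x `&` D) i.
  by rewrite DEF => -[xi Fi]; split=> //; right.
pose phi (u : idx (subfamily x E) + idx (subfamily x F)) :
    idx (subfamily x D) :=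
  match u with
  | inl i => exist _ (sval i) (mem_set (uE _ (set_mem (svalP i))))
  | inr i => exist _ (sval i) (mem_set (uF _ (set_mem (svalP i))))
  end.
exists phi; split; last by case=> i /=; congr elt; exact: val_inj.
apply: injective_surjective_bijective.
  have disj (i : idx (subfamily x E)) (j : idx (subfamily x F)) :
      sval i <> sval j.
    move=> ij; have [_ Ei] := set_mem (svalP i).
    have [_ Fj] := set_mem (svalP j); rewrite -ij in Fj.
    by have : (E `&` F) (sval i) by []; rewrite EF.
  move=> [i|i] [j|j] /(congr1 sval) /= ij.
  - by congr inl; exact: val_inj.
  - by case: (disj i j).
  - by case: (disj j i).
  - by congr inr; exact: val_inj.
case=> i xDi.
have : (idx x `&` D) i := set_mem xDi; rewrite DEF => -[xi [Ei|Fi]].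
- by exists (inl (exist _ i (mem_set (conj xi Ei)))); exact: val_inj.
- by exists (inr (exist _ i (mem_set (conj xi Fi)))); exact: val_inj.
Qed.

(* The neutral element of a product is neutral in all coordinates, so its axiom
   needs that some, not only all, neutral elements can be dropped. *)
Lemma summable_subfamily_neutral (x : fam I X) (D : set I) :
  summable sigma x -> (forall i : idx x, ~ D (sval i) -> elt i = neutral) ->
  summable sigma (subfamily x D).
Proof.
move=> /summable_remove_neutral[a]; rewrite /remove_elt.
set E := (E in subfamily x E) => Ea D0; exists a.
have x0 (i : idx x) : ~ E (sval i) -> elt i = neutral.
  by move=> Ei; apply: contrapT => i0; apply: Ei; exists i.
(* [E] collects the indices of the nonneutral entries, all of which lie in [D]; what [D] has beyond
   [E] contributes only neutral entries, whose sum is neutral. *)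
have DEF : idx x `&` D = idx x `&` (E `|` D `\` E).
  apply/seteqP; split=> i [xi].
    by move=> Di; split=> //; have [Ei|nEi] := pselect (E i); [left | right].
  case=> [[j /= j0 <-]|[Di _]]; split=> //; first exact: set_mem (svalP j).
  by apply: contrapT => Dj; exact: j0 (D0 j Dj).
apply: (sigma_sums_to (is_family_subfamilyU DEF _)).
  by apply/seteqP; split=> // i [Ei [_ /(_ Ei)]].
apply: sums_to_sum_fun (sums_to_add0 a).
  by exists (subfamily x E) => //; exact: is_family_elt.
apply: eq_sums_to (sums_to_neutral (countable_idxT _)) => i /=.
by apply/esym/x0; have [_ []] := set_mem (svalP i).
Qed.
End Sums.

(** The two sides differ only in their proofs of countability. *)
Lemma map_subfamily (I X Y : Type) (f : X -> Y) (x : fam I X) (D : set I) :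
  map_family f (subfamily x D) = subfamily (map_family f x) D.
Proof. exact: (congr1 (fun c => Fam c _) (Prop_irrelevance _ _)). Qed.

(** * Preservation of sums, neutral element and inverses by homomorphisms *)

Section Homomorphisms.
Context (I : Type) (X Y : weak_sigma_monoid I) (f : X -> Y).
Hypothesis f_hom : is_sigma_hom f.

Lemma sums_to_map (T : Type) (e : T -> X) (a : X) :
  sums_to e a -> sums_to (f \o e) (f a).
Proof.
move=> [x [phi [phi_bij phiE]] xa]; exists (map_family f x); last exact: f_hom.
by exists phi; split=> // t /=; rewrite phiE.
Qed.

Lemma sigma_hom_neutral : infinite_set [set: I] -> f neutral = neutral.
Proof.
move=> I_infinite; apply: sums_to_fun (sums_to_void Y I_infinite).
by apply: eq_sums_to (sums_to_map (sums_to_void X I_infinite)) => -[].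
Qed.

Lemma sigma_hom_inverse (a b : X) :
  infinite_set [set: I] -> sums_to (pairing a b) neutral ->
  sums_to (pairing (f a) (f b)) neutral.
Proof.
move=> I_infinite ab; rewrite -(sigma_hom_neutral I_infinite).
by apply: eq_sums_to (sums_to_map ab) => -[].
Qed.
End Homomorphisms.

(** * The initial structure for a jointly injective family of coordinate maps *)

(* [Q] stands for a subset of the product of the [Y k] that is closed under the
   coordinatewise partial sums, and [p] for the coordinate maps.  It is kept
   abstract because this product is too large to be the carrier of a weak
   Sigma-monoid when [K] ranges over all arrows out of a given one. *)
Section InitialStructure.
Context (I : Type) (I_infinite : infinite_set [set: I]).
Context (K : Type) (Y : K -> weak_sigma_monoid I) (Q : Type).
Context (p : forall k, Q -> Y k).
Hypothesis p_inj : forall q q', (forall k, p k q = p k q') -> q = q'.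
Hypothesis p_closed : forall x : fam I Q,
  (forall k, summable sigma (map_family (p k) x)) ->
  exists q, forall k, sigma (map_family (p k) x) = Some (p k q).

Definition initial_sigma (x : fam I Q) : option Q :=
  match pselect (exists q,
    forall k, sigma (map_family (p k) x) = Some (p k q)) with
  | left h => Some (sval (cid h))
  | right _ => None
  end.

Lemma initial_sigmaP (x : fam I Q) (q : Q) :
  initial_sigma x = Some q <->
  forall k, sigma (map_family (p k) x) = Some (p k q).
Proof.
rewrite /initial_sigma; case: pselect => [h|nh]; last first.
  by split=> // xq; case: nh; exists q.
case: (cid h) => q' /= xq'; split=> [[<-]//|xq].
by congr Some; apply: p_inj => k; apply: Some_inj; rewrite -xq -xq'.
Qed.

(** Here [p_closed] enters: once all coordinate sums exist, they are the coordinates of a point of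
    [Q]. *)
Lemma initial_summable (x : fam I Q) :
  summable initial_sigma x <-> forall k, summable sigma (map_family (p k) x).
Proof.
split=> [[q /initial_sigmaP xq] k|/p_closed[q /initial_sigmaP]].
  by exists (p k q).
by exists q.
Qed.

Lemma is_family_map (T : Type) (e : T -> Q) (x : fam I Q) (k : K) :
  is_family e x -> is_family (p k \o e) (map_family (p k) x).
Proof.
by move=> [phi [phi_bij phiE]]; exists phi; split=> // t /=; rewrite phiE.
Qed.

Lemma initial_reindex (x y : fam I Q) :
  reindexing x y -> initial_sigma x = initial_sigma y.
Proof.
move=> xy.
have E k : sigma (map_family (p k) x) = sigma (map_family (p k) y).
  exact/sigma_reindex/(is_family_map k xy).
case xE : (initial_sigma x) => [q|].
  by apply/esym/initial_sigmaP => k; rewrite -E; move/initial_sigmaP: xE.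
case yE : (initial_sigma y) => [q|//].
by rewrite -xE; apply/initial_sigmaP => k; rewrite E; move/initial_sigmaP: yE.
Qed.

Lemma initial_singleton (q : Q) (x : fam I Q) :
  is_singleton q x -> initial_sigma x = Some q.
Proof.
move=> xq; apply/initial_sigmaP => k; apply: sigma_singleton.
exact: is_family_map k xq.
Qed.

Lemma initial_neutral_exists : exists z : Q,
  forall x : fam I Q, is_empty_family x -> initial_sigma x = Some z.
Proof.
have [x x0] := is_family_exists (of_void Q) I_infinite (countableP _).
have E y k : is_empty_family y -> sigma (map_family (p k) y) = Some neutral.
  move=> /(is_family_map k) y0; apply: sigma_empty.
  by congr is_family: y0; apply: funext => -[].
have /p_closed[z zP] : forall k, summable sigma (map_family (p k) x).
  by move=> k; exists neutral; exact: E.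
by exists z => y y0; apply/initial_sigmaP => k; rewrite -zP !E.
Qed.

Definition initial_neutral : Q := sval (cid initial_neutral_exists).

Lemma initial_empty (x : fam I Q) :
  is_empty_family x -> initial_sigma x = Some initial_neutral.
Proof. exact: svalP (cid initial_neutral_exists) x. Qed.

Lemma initial_neutralE (k : K) : p k initial_neutral = neutral.
Proof.
have [x x0] := is_family_exists (of_void Q) I_infinite (countableP _).
have /initial_sigmaP/(_ k) := initial_empty x0.
rewrite (@sigma_empty _ _ (map_family (p k) x)) => [[]//|].
by congr is_family: (is_family_map k x0); apply: funext => -[].
Qed.

Lemma initial_subfamily (x : fam I Q) (D : set I) :
  summable initial_sigma x ->
  (forall i : idx x, ~ D (sval i) -> elt i = initial_neutral) ->
  summable initial_sigma (subfamily x D).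
Proof.
move=> /initial_summable xs D0; apply/initial_summable => k.
rewrite map_subfamily.
apply: (summable_subfamily_neutral I_infinite (xs k)) => i Di /=.
by rewrite D0 // initial_neutralE.
Qed.

Lemma initial_remove_neutral (x : fam I Q) :
  summable initial_sigma x ->
  summable initial_sigma (remove_elt initial_neutral x).
Proof.
move=> xs; apply: initial_subfamily xs _ => i i0.
by apply: contrapT => ni0; apply: i0; exists i.
Qed.

Definition map_families (k : K) (xs : fam I (fam I Q)) : fam I (fam I (Y k)) :=
  Fam (idx_countable xs) (fun j => map_family (p k) (elt j)).

(** The parameter [P] lets one proof serve both the finite axiom of weak Sigma-monoids and the
    unrestricted one of strong Sigma-monoids; likewise for flattening. *)
Lemma initial_bracketing (P : forall k, set (fam I (fam I (Y k)))) :
  (forall k, bracketing (@sigma I (Y k)) (P k)) ->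
  bracketing initial_sigma [set xs | forall k, P k (map_families k xs)].
Proof.
move=> br xs s x q Pxs xsx /[swap] /initial_sigmaP xq xss.
apply/initial_sigmaP => k; apply: (br k (map_families k xs)) (xq k) => //.
  exact: is_family_map k xsx.
by move=> j; have /initial_sigmaP := xss j.
Qed.

Lemma initial_flattening (P : forall k, set (fam I (fam I (Y k)))) :
  (forall k, flattening (@sigma I (Y k)) (P k)) ->
  flattening initial_sigma [set xs | forall k, P k (map_families k xs)].
Proof.
move=> fl xs s x q Pxs xsx /[swap] /initial_sigmaP xq xss.
apply/initial_sigmaP => k; apply: (fl k (map_families k xs)) (xq k) => //.
  exact: is_family_map k xsx.
by move=> j; have /initial_sigmaP := xss j.
Qed.

Definition initial_monoid : weak_sigma_monoid I.
Proof.
apply: (@WeakSigmaMonoid I Q initial_sigma initial_neutral).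
- exact: initial_reindex.
- exact: initial_singleton.
- exact: initial_empty.
- exact: initial_remove_neutral.
- move=> xs s x a fin_xs.
  exact: (initial_bracketing (fun k => @sigma_bracketing I (Y k))
    (fun k => fin_xs)).
- move=> xs s x a fin_xs.
  exact: (initial_flattening (fun k => @sigma_flattening I (Y k))
    (fun k => fin_xs)).
Defined.

Lemma initial_strong : (forall k, is_strong (Y k)) -> is_strong initial_monoid.
Proof.
move=> Y_strong; split.
- move=> x D /initial_summable xs; apply/initial_summable => k.
  by have [sub _ _] := Y_strong k; rewrite map_subfamily; exact: sub.
- move=> xs s x a _; apply: (initial_bracketing (P := fun=> setT)) => // k.
  by have [] := Y_strong k.
- move=> xs s x a _; apply: (initial_flattening (P := fun=> setT)) => // k.
  by have [] := Y_strong k.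
Qed.

Lemma initial_finitely_total :
  (forall k, is_finitely_total (Y k)) -> is_finitely_total initial_monoid.
Proof.
by move=> Y_ft x x_fin; apply/initial_summable => k; exact: (Y_ft k).
Qed.

(** Uniqueness of inverses forces each coordinate map to carry [neg] to the negation of [Y k]; that
    negation is a homomorphism, hence so is [neg]. *)
Lemma initial_sigma_group (neg : Q -> Q) :
  (forall k q, sums_to (pairing (p k q) (p k (neg q))) neutral) ->
  (forall k, is_sigma_group (Y k)) -> is_sigma_group initial_monoid.
Proof.
move=> negP Y_group; split.
  by apply: initial_finitely_total => k; have [] := Y_group k.
exists neg; split=> [q x qx|x q /initial_sigmaP xq].
  apply/initial_sigmaP => k; rewrite initial_neutralE.
  apply: sigma_sums_to (negP k q).
  by congr is_family: (is_family_map k qx); apply: funext => -[].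
apply/initial_sigmaP => k; have [_ [negk [negkP negk_hom]]] := Y_group k.
have negE q' : p k (neg q') = negk (p k q').
  apply: (inverse_unique I_infinite (negP k q')).
  have [y yP] :=
    is_family_exists (pairing (p k q') (negk (p k q'))) I_infinite
      (countableP _).
  by exists y => //; exact: negkP yP.
rewrite negE -(negk_hom _ _ (xq k)); congr sigma; congr Fam.
by apply: funext => i /=; rewrite negE.
Qed.
End InitialStructure.

(** * Terms and their partial evaluation *)

Inductive term (I X : Type) : Type :=
| Gen of X
| Neg of term I X
| Sum (A : set I) of countable A & A -> term I X.
Arguments Gen {I X}.
Arguments Neg {I X}.
Arguments Sum {I X A}.

(** A relation and not a function, since in [Y] an inverse or a sum may fail to exist. *)
Fixpoint value (I X : Type) (Y : weak_sigma_monoid I) (f : X -> Y)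
    (t : term I X) (y : Y) : Prop :=
  match t with
  | Gen a => y = f a
  | Neg t => exists2 z, value f t z & sums_to (pairing z y) neutral
  | Sum A cA e => exists2 s : A -> Y,
      forall i, value f (e i) (s i) & sigma (Fam cA s) = Some y
  end.

Lemma value_fun (I X : Type) (Y : weak_sigma_monoid I) (f : X -> Y)
    (t : term I X) (y y' : Y) :
  infinite_set [set: I] -> value f t y -> value f t y' -> y = y'.
Proof.
move=> I_infinite; elim: t y y' => [a|t IH|A cA e IH] y y' /= => [-> ->//| |].
  by move=> [z tz zy] [z' /(IH _ _ tz) <-]; exact: inverse_unique.
move=> [s es sy] [s' es' s'y'].
have ss' : s = s' by apply: funext => i; exact: IH (es i) (es' i).
by move: s'y'; rewrite -ss' sy => -[].
Qed.

(** * The reflection of [X] into the class [P] *)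

Section Reflection.
Context (I : Type) (I_infinite : infinite_set [set: I]).
Context (X : weak_sigma_monoid I) (P : weak_sigma_monoid I -> Prop).

Record arrow := Arrow {
  target : weak_sigma_monoid I;
  target_in : P target;
  arrow_hom : sigma_hom X target
}.

Definition defined (t : term I X) : Prop :=
  forall k : arrow, exists y, value (arrow_hom k) t y.

Definition term_class (t : term I X) : set (term I X) :=
  [set u | forall (k : arrow) y,
    value (arrow_hom k) u y <-> value (arrow_hom k) t y].

(* A term with a value under every arrow is a point of the product of the
   targets; the class of the term is a small name for that point. *)
Definition reflection_carrier : Type :=
  {C : set (term I X) | exists2 t, defined t & C = term_class t}.

Definition reflection_class (t : term I X) (dt : defined t) :
    reflection_carrier :=
  exist _ (term_class t) (ex_intro2 _ _ t dt erefl).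

Lemma reflection_classP (q : reflection_carrier) :
  exists t (dt : defined t), q = reflection_class dt.
Proof.
by case: q => C [t dt CE]; exists t, dt; exact: eq_exist.
Qed.

Lemma reflection_value (k : arrow) (q : reflection_carrier) :
  {y | forall t, sval q t -> value (arrow_hom k) t y}.
Proof.
apply: cid; have [t [dt ->]] := reflection_classP q.
by have [y ty] := dt k; exists y => u /= ut; apply/ut.
Qed.

Definition reflection_proj (k : arrow) (q : reflection_carrier) : target k :=
  sval (reflection_value k q).

Lemma reflection_projP (k : arrow) (t : term I X) (dt : defined t) y :
  reflection_proj k (reflection_class dt) = y <-> value (arrow_hom k) t y.
Proof.
have tv : value (arrow_hom k) t (reflection_proj k (reflection_class dt)).
  by apply: (svalP (reflection_value k (reflection_class dt))).
by split=> [<-//|]; exact: value_fun.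
Qed.

Arguments reflection_projP k {t} dt {y}.

Lemma reflection_proj_inj (q r : reflection_carrier) :
  (forall k, reflection_proj k q = reflection_proj k r) -> q = r.
Proof.
have [t [dt ->]] := reflection_classP q.
have [u [du ->]] := reflection_classP r.
move=> E; apply: eq_exist; apply/seteqP.
have tu k y : value (arrow_hom k) t y <-> value (arrow_hom k) u y.
  by rewrite -(reflection_projP k dt) -(reflection_projP k du) E.
by split=> v vt k y; rewrite vt // tu.
Qed.

(** Values are unique, so the only candidates for the values of the subterms are the coordinates of
    their classes. *)
Lemma reflection_sum (A : set I) (cA : countable A) (e : A -> term I X)
    (de : forall i, defined (e i)) (k : arrow) y :
  value (arrow_hom k) (Sum cA e) y <->
  sigma (map_family (reflection_proj k)
    (Fam cA (fun i => reflection_class (de i)))) = Some y.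
Proof.
have eE i :
    value (arrow_hom k) (e i) (reflection_proj k (reflection_class (de i))).
  exact/(reflection_projP k (de i)).
split=> [[s es <-]|sy] /=; last exact: (ex_intro2 _ _ _ eE sy).
congr sigma; congr Fam; apply: funext => i.
exact: (reflection_projP k (de i)).2 (es i).
Qed.

Lemma reflection_family (x : fam I reflection_carrier) :
  exists (e : idx x -> term I X) (de : forall i, defined (e i)),
    x = Fam (idx_countable x) (fun i => reflection_class (de i)).
Proof.
have /choice[e eP] (i : idx x) :
    exists t (dt : defined t), elt i = reflection_class dt.
  exact: reflection_classP.
exists e, (fun i => sval (cid (eP i))).
case: x e eP => A cA x e eP; congr Fam; apply: funext => i.
exact: svalP (cid (eP i)).
Qed.

Lemma reflection_closed (x : fam I reflection_carrier) :
  (forall k, summable sigma (map_family (reflection_proj k) x)) ->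
  exists q, forall k,
    sigma (map_family (reflection_proj k) x) = Some (reflection_proj k q).
Proof.
have [e [de ->]] := reflection_family x => xs.
(* Representatives of all entries are grafted into a single [Sum] term, which names the sum of the
   family. *)
have dS : defined (Sum (idx_countable x) e).
  by move=> k; have [y xy] := xs k; exists y; exact/reflection_sum.
exists (reflection_class dS) => k; apply/reflection_sum.
exact/(reflection_projP k dS).
Qed.

Definition reflection : weak_sigma_monoid I :=
  initial_monoid I_infinite reflection_proj_inj reflection_closed.

Lemma defined_Gen (a : X) : defined (Gen a).
Proof. by move=> k; exists (arrow_hom k a). Qed.

Definition reflection_gen (a : X) : reflection :=
  reflection_class (defined_Gen a).

Lemma reflection_proj_gen (k : arrow) (a : X) :
  reflection_proj k (reflection_gen a) = arrow_hom k a.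
Proof. exact/reflection_projP. Qed.

Lemma reflection_gen_hom : is_sigma_hom reflection_gen.
Proof.
move=> x a xa; apply/(initial_sigmaP reflection_proj_inj) => k.
rewrite reflection_proj_gen -(sigma_funP (arrow_hom k) xa).
by congr sigma; congr Fam; apply: funext => i /=; exact: reflection_proj_gen.
Qed.

Definition reflection_unit : sigma_hom X reflection :=
  SigmaHom reflection_gen_hom.

Lemma reflection_proj_hom (k : arrow) :
  @is_sigma_hom I reflection (target k) (reflection_proj k).
Proof. by move=> x a /(initial_sigmaP reflection_proj_inj). Qed.

(** The morphism [f] is itself one of the arrows, and the extension is the coordinate map at that
    arrow. *)
Lemma reflection_exists (Y : weak_sigma_monoid I) (f : sigma_hom X Y) :
  P Y -> exists g : sigma_hom reflection Y, sigma_comp g reflection_unit = f.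
Proof.
move=> PY; exists (SigmaHom (reflection_proj_hom (Arrow PY f))).
apply: sigma_hom_eq; apply: funext => a.
exact: reflection_proj_gen (Arrow PY f) a.
Qed.

(** Induction on a term naming the point: homomorphisms preserve sums and existing inverses, and
    subterms of a defined term are defined. *)
Lemma reflection_unique (Y : weak_sigma_monoid I)
    (g h : sigma_hom reflection Y) :
  sigma_comp g reflection_unit = sigma_comp h reflection_unit -> g = h.
Proof.
move=> gh; apply: sigma_hom_eq; apply: funext => q.
have [t [dt ->]] := reflection_classP q.
elim: t dt {q} => [a|t IH|A cA e IH] dt.
- have -> : dt = defined_Gen a by exact: Prop_irrelevance.
  by have := congr1 (fun f : sigma_hom X Y => f a) gh.
- have dt' : defined t by move=> k; have [y [z]] := dt k; exists z.
  pose u : reflection := reflection_class dt'.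
  pose v : reflection := reflection_class dt.
  (* The classes of [t] and [Neg t] are inverse in every coordinate, hence in the reflection; their
     images under [g] and [h] are then inverse in [Y]. *)
  have inv : sums_to (pairing u v) neutral.
    have [x xP] :=
      is_family_exists (pairing u v) I_infinite (countableP _).
    exists x => //; apply/(initial_sigmaP reflection_proj_inj) => k.
    rewrite initial_neutralE.
    have [z tz zy] := (reflection_projP k dt).1 erefl.
    apply: (sigma_sums_to (is_family_map reflection_proj k xP)).
    apply: eq_sums_to zy => -[] //=.
    exact/esym/reflection_projP.
  have gu := sigma_hom_inverse (sigma_funP g) I_infinite inv.
  have hu := sigma_hom_inverse (sigma_funP h) I_infinite inv.
  by apply: (inverse_unique I_infinite gu); rewrite (IH dt').
- have de i : defined (e i).
    move=> k; have [y [s es _]] := dt k.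
    by exists (s i); exact: es.
  pose x : fam I reflection := Fam cA (fun i => reflection_class (de i)).
  have xE : sigma x = Some (reflection_class dt : reflection).
    apply/(initial_sigmaP reflection_proj_inj) => k.
    exact/reflection_sum/(reflection_projP k dt).
  apply: Some_inj; rewrite -(sigma_funP g xE) -(sigma_funP h xE).
  by congr sigma; congr Fam; apply: funext => i /=; exact: IH.
Qed.

Lemma reflection_strong :
  (forall Y, P Y -> is_strong Y) -> is_strong reflection.
Proof.
move=> P_strong; apply: initial_strong => k; exact: P_strong (target_in k).
Qed.

Lemma reflection_finitely_total :
  (forall Y, P Y -> is_finitely_total Y) -> is_finitely_total reflection.
Proof.
move=> P_ft; apply: initial_finitely_total => k; exact: P_ft (target_in k).
Qed.

Lemma reflection_sigma_group :
  (forall Y, P Y -> is_sigma_group Y) -> is_sigma_group reflection.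
Proof.
move=> P_group.
have /choice[neg negP] (q : reflection) : exists r : reflection, forall k,
    sums_to (pairing (reflection_proj k q) (reflection_proj k r)) neutral.
  have [t [dt ->]] := reflection_classP q.
  (* All targets are Sigma-groups, so the value of [t] under each arrow has an inverse. *)
  have dN : defined (Neg t).
    move=> k; have [y ty] := dt k.
    have [_ [neg [negP _]]] := P_group _ (target_in k).
    have [x xP] :=
      is_family_exists (pairing y (neg y)) I_infinite (countableP _).
    by exists (neg y), y => //; exists x => //; exact: negP xP.
  exists (reflection_class dN) => k.
  have /= [z] := (reflection_projP k dN).1 erefl.
  by move/(reflection_projP k dt) => <-.
apply: (initial_sigma_group I_infinite _ _ (fun k q => negP q k)) => k.
exact: P_group (target_in k).
Qed.
End Reflection.

(** * Adjunctions from universal arrows, and the three embeddings *)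

Lemma universal_arrows_right_adjoint (C D : category) (G : functor D C) :
  (forall c : C, exists (r : D) (u : hom c (G r)),
     forall (d : D) (f : hom c (G d)),
     exists! g : hom r d, compm (fmap G g) u = f) ->
  is_right_adjoint G.
Proof.
move=> univ.
pose L c := sval (cid (univ c)).
pose u c : hom c (G (L c)) := sval (cid (svalP (cid (univ c)))).
have uP c d (f : hom c (G d)) :
    exists! g : hom (L c) d, compm (fmap G g) (u c) = f.
  exact: (svalP (cid (svalP (cid (univ c))))) d f.
pose lift c d (f : hom c (G d)) := sval (cid (uP c d f)).
have liftE c d (f : hom c (G d)) : compm (fmap G (lift _ _ f)) (u c) = f.
  exact: (svalP (cid (uP c d f))).1.
have inj c d (g h : hom (L c) d) :
    compm (fmap G g) (u c) = compm (fmap G h) (u c) -> g = h.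
  have [k [_ kU]] := uP c d (compm (fmap G h) (u c)).
  by move=> gh; rewrite -(kU _ gh) -(kU _ erefl).
(* The only action on morphisms that makes [u] natural; functoriality then follows from uniqueness
   of lifts. *)
pose Lmap c c' (f : hom c c') := lift _ _ (compm (u c') f).
have Lid c : Lmap _ _ (idm c) = idm (L c).
  by apply: inj; rewrite liftE fmap_id comp_idl comp_idr.
have Lcomp a b c (g : hom b c) (f : hom a b) :
    Lmap _ _ (compm g f) = compm (Lmap _ _ g) (Lmap _ _ f).
  by apply: inj; rewrite liftE fmap_comp -comp_assoc liftE !comp_assoc liftE.
exists (Functor Lid Lcomp), (fun c d h => compm (fmap G h) (u c)); split=> /=.
- by move=> c d; exists (lift c d) => [g|f]; [exact: inj | exact: liftE].
- by move=> c' c d f h; rewrite fmap_comp -comp_assoc liftE comp_assoc.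
- by move=> c d d' g h; rewrite fmap_comp comp_assoc.
Qed.

Lemma reflection_universal (I : Type) (I_infinite : infinite_set [set: I])
    (P : weak_sigma_monoid I -> Prop) (X Y : weak_sigma_monoid I)
    (f : sigma_hom X Y) :
  P Y -> exists! g : sigma_hom (reflection I_infinite X P) Y,
    sigma_comp g (reflection_unit I_infinite X P) = f.
Proof.
move=> PY; have [g gf] := reflection_exists I_infinite f PY.
by exists g; split=> // h hf; apply: reflection_unique; rewrite gf hf.
Qed.

Theorem theorem16 (I : Type) (I_infinite : infinite_set (@setT I)) :
  is_right_adjoint (embed_s_w I) /\
  is_right_adjoint (embed_g_ft I) /\
  is_right_adjoint (embed_ft_w I).
Proof.
split; [|split]; apply: universal_arrows_right_adjoint => c.
- exists (exist _ _ (@reflection_strong I I_infinite c _ (fun Y => id))).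
  exists (reflection_unit I_infinite c (@is_strong I)) => d f.
  exact: reflection_universal f (svalP d).
(* The reflection is formed among all weak Sigma-monoids; fullness of the subcategories makes it
   universal among finitely total ones as well. *)
- exists (exist _ _ (@reflection_sigma_group I I_infinite (sval c) _
    (fun Y => id))).
  exists (reflection_unit I_infinite (sval c) (@is_sigma_group I)) => d f.
  exact: reflection_universal f (svalP d).
- exists (exist _ _ (@reflection_finitely_total I I_infinite c _
    (fun Y => id))).
  exists (reflection_unit I_infinite c (@is_finitely_total I)) => d f.
  exact: reflection_universal f (svalP d).
Qed.
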